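(* Let $(\mathcal C,p)$ be a universe category with universe $p:\widetilde U\to U$ and let $CC=CC(\mathcal C,p)$. There is an isomorphism of presheaves on $CC$ $$u_1:\mathcal{O}b_1\to int^{\circ}(Yo(U))$$ such that for $\Gamma=(n,A)$ and $T=(n+1,(A,F))$ one has $u_{1,\Gamma}(T)=F$.
   Context: Conventions. Composition is written in diagrammatic order: for $f:X\to Y$, $g:Y\to Z$ the composite is $f\circ g:X\to Z$. $\amalg_{i\in I}A_i$ denotes the set of pairs $(i,a)$, $i\in I$, $a\in A_i$. $Yo$ is the Yoneda embedding, $Yo(Y)(X)=Mor(X,Y)$. For a functor $\Phi:C\to C'$ and a presheaf $\mathcal G$ on $C'$, $\Phi^{\circ}(\mathcal G)(X)=\mathcal G(\Phi(X))$. Universes. A universe in a category $\mathcal C$ is a morphism $p:\widetilde U\to U$ with a choice, for every $F:X\to U$, of a pullback square with vertex $(X;F)$ and projections $p_F:(X;F)\to X$, $Q(F):(X;F)\to\widetilde U$, $p_F\circ F=Q(F)\circ p$. For $f:X'\to X$ and $F:X\to U$, $Q(f,F):(X';f\circ F)\to(X;F)$ is the unique morphism with $Q(f,F)\circ p_F=p_{f\circ F}\circ f$ and $Q(f,F)\circ Q(F)=Q(f\circ F)$. A universe category $(\mathcal C,p)$ is a category with a universe $p$ and a chosen final object $pt$. The C-system $CC(\mathcal C,p)$. Define recursively sets $Ob_n(\mathcal C,p)$ and functions $int:Ob_n(\mathcal C,p)\to Ob(\mathcal C)$: $Ob_0(\mathcal C,p)=\{tt\}$, $int(tt)=pt$;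 $Ob_{n+1}(\mathcal C,p)=\amalg_{A\in Ob_n(\mathcal C,p)}Mor_{\mathcal C}(int(A),U)$, $int(A,F)=(int(A);F)$. Objects of $CC(\mathcal C,p)$ are pairs $\Gamma=(n,A)$ with $A\in Ob_n(\mathcal C,p)$, and $int(\Gamma)=int(A)$. Morphisms $\Gamma'\to\Gamma$ are (copies of) the morphisms $int(\Gamma')\to int(\Gamma)$ of $\mathcal C$, so that $int:CC(\mathcal C,p)\to\mathcal C$ is a fully faithful functor. Set $l(n,A)=n$, $ft(n+1,(A,F))=(n,A)$, $ft(0,tt)=(0,tt)$; for $T=(n+1,(A,F))$, $p_T:T\to ft(T)$ is the morphism with $int(p_T)=p_F$; for such $T$ and $f:(n',A')\to(n,A)$, $f^*(T)=(n'+1,(A',int(f)\circ F))$ and $q(f,T):f^*(T)\to T$ is the morphism with $int(q(f,T))=Q(int(f),F)$. The presheaf $\mathcal{O}b_1$ on $CC(\mathcal C,p)$: $\mathcal{O}b_1(\Gamma)=\{T\mid l(T)=l(\Gamma)+1,\ ft(T)=\Gamma\}$ and $\mathcal{O}b_1(f)(T)=f^*(T)$. *)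

(* Defs.v *)
From Stdlib Require Import ProofIrrelevance IndefiniteDescription.

Set Implicit Arguments.
Unset Strict Implicit.

(* Sets are rendered as types, and equality of elements
   (including objects and morphisms of categories) is Leibniz equality. *)

Record category := Category {
  Ob :> Type;
  Mor : Ob -> Ob -> Type;
  idm : forall X, Mor X X;
  comp : forall X Y Z, Mor X Y -> Mor Y Z -> Mor X Z;
  comp_idl : forall X Y (f : Mor X Y), comp (idm X) f = f;
  comp_idr : forall X Y (f : Mor X Y), comp f (idm Y) = f;
  comp_assoc : forall W X Y Z (f : Mor W X) (g : Mor X Y) (h : Mor Y Z),
    comp (comp f g) h = comp f (comp g h) }.

Arguments Mor {c} X Y.
Arguments idm {c} X.
Arguments comp {c X Y Z} f g.

(* Diagrammatic order: first f, then g. *)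
Notation "f ;; g" := (comp f g) (at level 40, left associativity).

Record functor (C D : category) := Functor {
  fob :> C -> D;
  fmor : forall X Y : C, Mor X Y -> Mor (fob X) (fob Y);
  fmor_id : forall X : C, fmor (idm X) = idm (fob X);
  fmor_comp : forall (X Y Z : C) (f : Mor X Y) (g : Mor Y Z),
    fmor (f ;; g) = fmor f ;; fmor g }.

Arguments fmor {C D} _ {X Y} _.

Record presheaf (C : category) := Presheaf {
  psh :> C -> Type;
  psh_map : forall X Y : C, Mor X Y -> psh Y -> psh X;
  psh_id : forall (X : C) (x : psh X), psh_map (idm X) x = x;
  psh_comp : forall (X Y Z : C) (f : Mor X Y) (g : Mor Y Z) (z : psh Z),
    psh_map (f ;; g) z = psh_map f (psh_map g z) }.

Arguments psh_map {C} _ {X Y} _ _.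

Record presheaf_mor (C : category) (F G : presheaf C) := PresheafMor {
  nat_fun :> forall X : C, F X -> G X;
  naturality : forall (X Y : C) (f : Mor X Y) (y : F Y),
    nat_fun (psh_map F f y) = psh_map G f (nat_fun y) }.

Arguments nat_fun {C F G} _ X _.

(* Equality of morphisms of presheaves is equality of all their values. *)
Definition is_presheaf_iso (C : category) (F G : presheaf C)
    (u : presheaf_mor F G) : Prop :=
  exists v : presheaf_mor G F,
    (forall X x, v X (u X x) = x) /\ (forall X y, u X (v X y) = y).

Definition Yo (C : category) (Y : C) : presheaf C :=
  @Presheaf C (fun X => Mor X Y) (fun _ _ f g => f ;; g)
    (fun _ g => comp_idl g) (fun _ _ _ f g h => comp_assoc f g h).

Lemma restrict_id (C D : category) (Phi : functor C D) (G : presheaf D)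
    (X : C) (x : G (Phi X)) : psh_map G (fmor Phi (idm X)) x = x.
Proof. rewrite fmor_id. apply psh_id. Qed.

Lemma restrict_comp (C D : category) (Phi : functor C D) (G : presheaf D)
    (X Y Z : C) (f : Mor X Y) (g : Mor Y Z) (z : G (Phi Z)) :
  psh_map G (fmor Phi (f ;; g)) z =
  psh_map G (fmor Phi f) (psh_map G (fmor Phi g) z).
Proof. rewrite fmor_comp. apply psh_comp. Qed.

(* The presheaf written Phi with superscript circle applied to G. *)
Definition restrict (C D : category) (Phi : functor C D) (G : presheaf D)
    : presheaf C :=
  @Presheaf C (fun X => G (Phi X)) (fun _ _ f => psh_map G (fmor Phi f))
    (restrict_id (Phi := Phi) (G := G)) (restrict_comp (Phi := Phi) (G := G)).

Definition is_final (C : category) (T : C) : Prop :=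
  forall X : C, exists! f : Mor X T, True.

(* The square  P --b--> Y   is a pullback.
               |a       |g
               X --f--> Z                   *)
Definition is_pullback (C : category) (P X Y Z : C) (a : Mor P X) (b : Mor P Y)
    (f : Mor X Z) (g : Mor Y Z) : Prop :=
  a ;; f = b ;; g /\
  forall (W : C) (x : Mor W X) (y : Mor W Y), x ;; f = y ;; g ->
    exists! m : Mor W P, m ;; a = x /\ m ;; b = y.

Record universe (C : category) := Universe {
  U : C;
  Utilde : C;
  univ_p : Mor Utilde U;
  pb : forall X : C, Mor X U -> C;
  pb_p : forall (X : C) (F : Mor X U), Mor (pb F) X;
  pb_Q : forall (X : C) (F : Mor X U), Mor (pb F) Utilde;
  pb_pullback : forall (X : C) (F : Mor X U),
    is_pullback (pb_p F) (pb_Q F) F univ_p }.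

Arguments pb {C} _ {X} F.
Arguments pb_p {C} _ {X} F.
Arguments pb_Q {C} _ {X} F.

Record universe_category := UniverseCategory {
  ucat :> category;
  univ : universe ucat;
  pt : ucat;
  pt_final : is_final pt }.

Lemma Q_ex (C : category) (p : universe C) (X' X : C) (f : Mor X' X)
    (F : Mor X (U p)) :
  exists! m : Mor (pb p (f ;; F)) (pb p F),
    m ;; pb_p p F = pb_p p (f ;; F) ;; f /\ m ;; pb_Q p F = pb_Q p (f ;; F).
Proof.
apply (proj2 (pb_pullback F)).
rewrite comp_assoc. exact (proj1 (pb_pullback (f ;; F))).
Qed.

Definition Q (C : category) (p : universe C) (X' X : C) (f : Mor X' X)
    (F : Mor X (U p)) : Mor (pb p (f ;; F)) (pb p F) :=
  proj1_sig (constructive_definite_description _ (Q_ex f F)).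

(* Ob_n and int : Ob_n -> Ob(C) are defined simultaneously, so the recursion
   returns the set together with the function. *)
Fixpoint Obn_int (C : universe_category) (n : nat) : {O : Type & O -> C} :=
  match n with
  | 0 => existT (fun O : Type => O -> ucat C) unit (fun _ => pt C)
  | S m =>
      let i := projT2 (Obn_int C m) in
      existT (fun O : Type => O -> ucat C)
        {A : projT1 (Obn_int C m) & Mor (i A) (U (univ C))}
        (fun AF => pb (univ C) (projT2 AF))
  end.

Definition Obn (C : universe_category) (n : nat) : Type := projT1 (Obn_int C n).

Definition intn (C : universe_category) (n : nat) (A : Obn C n) : C :=
  projT2 (Obn_int C n) A.

(* The element (A, F) of Ob_{n+1}. *)
Definition pairn (C : universe_category) (n : nat) (A : Obn C n)
    (F : Mor (intn A) (U (univ C))) : Obn C (S n) :=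
  existT _ A F.

Definition CCob (C : universe_category) : Type := {n : nat & Obn C n}.

Definition obj (C : universe_category) (n : nat) (A : Obn C n) : CCob C :=
  existT _ n A.

Definition int_ob (C : universe_category) (Gamma : CCob C) : C :=
  intn (projT2 Gamma).

Definition CC (C : universe_category) : category :=
  @Category (CCob C) (fun Gamma' Gamma => Mor (int_ob Gamma') (int_ob Gamma))
    (fun Gamma => idm (int_ob Gamma)) (fun _ _ _ f g => f ;; g)
    (fun _ _ f => comp_idl f) (fun _ _ f => comp_idr f)
    (fun _ _ _ _ f g h => comp_assoc f g h).

Definition int (C : universe_category) : functor (CC C) C :=
  @Functor (CC C) C (@int_ob C) (fun _ _ f => f)
    (fun _ => eq_refl) (fun _ _ _ _ _ => eq_refl).

Definition l (C : universe_category) (Gamma : CC C) : nat := projT1 Gamma.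

Definition ft (C : universe_category) (T : CC C) : CC C :=
  match T with
  | existT _ n A =>
      match n return Obn C n -> CC C with
      | 0 => fun A => obj (n := 0) A
      | S m => fun AF => obj (projT1 AF)
      end A
  end.

(* The object (n+1, (A, F)) for Gamma = (n, A). *)
Definition ext (C : universe_category) (Gamma : CC C)
    (F : Mor (int C Gamma) (U (univ C))) : CC C :=
  obj (pairn (A := projT2 Gamma) F).

Definition p_ (C : universe_category) (Gamma : CC C)
    (F : Mor (int C Gamma) (U (univ C))) : Mor (ext F) Gamma :=
  pb_p (univ C) F.

Definition q (C : universe_category) (Gamma' Gamma : CC C)
    (f : Mor Gamma' Gamma) (F : Mor (int C Gamma) (U (univ C))) :
  Mor (ext (fmor (int C) f ;; F)) (ext F) :=
  Q (fmor (int C) f) F.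

Definition over (C : universe_category) (Gamma T : CC C) : Prop :=
  l T = l Gamma + 1 /\ ft T = Gamma.

Lemma over_0 (C : universe_category) (Gamma : CC C) (A : Obn C 0) :
  ~ over Gamma (obj A).
Proof. intros [h _]. simpl in h. rewrite PeanoNat.Nat.add_1_r in h. discriminate h. Qed.

(* f^*(T) for f : Gamma' -> Gamma and T over Gamma: the equation ft(T) = Gamma
   transports f to a morphism into ft(T); no such T has length 0. *)
Definition star (C : universe_category) (Gamma' Gamma : CC C)
    (f : Mor Gamma' Gamma) (T : CC C) : over Gamma T -> CC C :=
  match T with
  | existT _ n A =>
      match n return forall A : Obn C n, over Gamma (obj A) -> CC C with
      | 0 => fun A h => False_rect _ (over_0 h)
      | S m => fun AF h =>
          let f' : Mor Gamma' (obj (projT1 AF)) :=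
            match h with
            | conj _ e => eq_rect_r (fun G : CC C => Mor Gamma' G) f e
            end in
          ext (Gamma := Gamma') (fmor (int C) f' ;; projT2 AF)
      end A
  end.

Lemma starE (C : universe_category) (Gamma' Gamma : CC C)
    (f : Mor Gamma' Gamma) (F : Mor (int C Gamma) (U (univ C)))
    (h : over Gamma (ext F)) :
  star f h = ext (fmor (int C) f ;; F).
Proof.
destruct Gamma as [n A].
destruct h as [h1 h2]. simpl.
rewrite (proof_irrelevance _ h2 eq_refl). reflexivity.
Qed.

Lemma over_ext (C : universe_category) (Gamma : CC C)
    (F : Mor (int C Gamma) (U (univ C))) : over Gamma (ext F).
Proof.
split.
- simpl. symmetry. apply PeanoNat.Nat.add_1_r.
- destruct Gamma. reflexivity.
Qed.

Lemma over_inv (C : universe_category) (Gamma T : CC C) :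
  over Gamma T -> exists F : Mor (int C Gamma) (U (univ C)), T = ext F.
Proof.
destruct T as [[|n] A]; intro h.
- destruct (over_0 h).
- destruct A as [A F]. destruct h as [_ h2]. simpl in h2. subst Gamma.
  exists F. reflexivity.
Qed.

Lemma star_over (C : universe_category) (Gamma' Gamma : CC C)
    (f : Mor Gamma' Gamma) (T : CC C) (h : over Gamma T) :
  over Gamma' (star f h).
Proof. destruct (over_inv h) as [F ->]. rewrite starE. apply over_ext. Qed.

Definition Ob1_set (C : universe_category) (Gamma : CC C) : Type :=
  {T : CC C | over Gamma T}.

Definition Ob1_map (C : universe_category) (Gamma' Gamma : CC C)
    (f : Mor Gamma' Gamma) (T : Ob1_set Gamma) : Ob1_set Gamma' :=
  exist _ (star f (proj2_sig T)) (star_over f (proj2_sig T)).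

Lemma Ob1_eq (C : universe_category) (Gamma : CC C) (S T : Ob1_set Gamma) :
  proj1_sig S = proj1_sig T -> S = T.
Proof. apply eq_sig_hprop. intros; apply proof_irrelevance. Qed.

Lemma Ob1_id (C : universe_category) (Gamma : CC C) (T : Ob1_set Gamma) :
  Ob1_map (idm Gamma) T = T.
Proof.
apply Ob1_eq. destruct T as [T h]. simpl.
destruct (over_inv h) as [F ->]. rewrite starE. simpl.
now rewrite comp_idl.
Qed.

Lemma Ob1_comp (C : universe_category) (X Y Z : CC C) (f : Mor X Y)
    (g : Mor Y Z) (T : Ob1_set Z) :
  Ob1_map (f ;; g) T = Ob1_map f (Ob1_map g T).
Proof.
apply Ob1_eq. destruct T as [T h]. simpl.
destruct (over_inv h) as [F ->].
generalize (star_over g h). rewrite !starE. intro h'. rewrite starE. simpl.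
now rewrite comp_assoc.
Qed.

Definition Ob1 (C : universe_category) : presheaf (CC C) :=
  @Presheaf (CC C) (@Ob1_set C) (@Ob1_map C) (@Ob1_id C) (@Ob1_comp C).

(* Main.v *)
Require Import Defs.
From Stdlib Require Import ProofIrrelevance IndefiniteDescription.

(** An object of length one more than [Gamma = (n, A)] lying over it is the
    same thing as a pair [(A, F)], so [F |-> ext F] is a bijection from
    [Mor (int Gamma) U] onto [Ob1 Gamma]: every [T] over [Gamma] is some [ext F]
    ([over_inv]), and [F] is determined by [T] ([ext_inj]).  It is natural because
    [f^*(ext F) = ext (int f ;; F)] ([starE]), that is, pulling back on the
    C-system side is precomposition on the representable side.  The morphism
    [u1] is the pointwise inverse of this natural bijection: it sends [T] to the
    unique [F] with [T = ext F]. *)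

(** The second components of equal dependent pairs are equal only up to
    transport along a loop at the length, then along one at [A].  Objects of [C] need
    not have decidable equality, so it is proof irrelevance that makes the
    latter transport trivial. *)
Lemma ext_inj (C : universe_category) (Gamma : CC C)
    (F G : Mor (int C Gamma) (U (univ C))) : ext F = ext G -> F = G.
Proof.
destruct Gamma as [n A]; intro e.
exact (inj_pair2 _ _ _ _ _ (inj_pair2 _ _ _ _ _ e)).
Qed.

Lemma ext_unique (C : universe_category) (Gamma : CC C) (T : Ob1 C Gamma) :
  exists! F : Mor (int C Gamma) (U (univ C)), proj1_sig T = ext F.
Proof.
destruct (over_inv (proj2_sig T)) as [F e].
exists F; split; [exact e|].
intros G e'. apply ext_inj. now rewrite <- e.
Qed.

Definition classify (C : universe_category) (Gamma : CC C) (T : Ob1 C Gamma) :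
    Mor (int C Gamma) (U (univ C)) :=
  proj1_sig (constructive_definite_description _ (ext_unique C Gamma T)).

Lemma ext_classify (C : universe_category) (Gamma : CC C) (T : Ob1 C Gamma) :
  proj1_sig T = ext (classify C Gamma T).
Proof. exact (proj2_sig (constructive_definite_description _ (ext_unique C Gamma T))). Qed.

Lemma classify_unique (C : universe_category) (Gamma : CC C) (T : Ob1 C Gamma)
    (F : Mor (int C Gamma) (U (univ C))) :
  proj1_sig T = ext F -> classify C Gamma T = F.
Proof. intro e. apply ext_inj. now rewrite <- ext_classify. Qed.

Definition extend (C : universe_category) (Gamma : CC C)
    (F : Mor (int C Gamma) (U (univ C))) : Ob1 C Gamma :=
  exist _ (ext F) (over_ext F).

Lemma extend_natural (C : universe_category) (X Y : CC C) (f : Mor X Y)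
    (F : Mor (int C Y) (U (univ C))) :
  extend C X (fmor (int C) f ;; F) = psh_map (Ob1 C) f (extend C Y F).
Proof. apply Ob1_eq. symmetry. apply starE. Qed.

Lemma classify_extend (C : universe_category) (Gamma : CC C)
    (F : Mor (int C Gamma) (U (univ C))) :
  classify C Gamma (extend C Gamma F) = F.
Proof. now apply classify_unique. Qed.

Lemma extend_classify (C : universe_category) (Gamma : CC C)
    (T : Ob1 C Gamma) :
  extend C Gamma (classify C Gamma T) = T.
Proof. apply Ob1_eq. symmetry. apply ext_classify. Qed.

(** Naturality passes from [extend] to its pointwise inverse. *)
Lemma classify_natural (C : universe_category) (X Y : CC C) (f : Mor X Y)
    (T : Ob1 C Y) :
  classify C X (psh_map (Ob1 C) f T) = fmor (int C) f ;; classify C Y T.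
Proof.
rewrite <- (extend_classify C Y T) at 1.
rewrite <- extend_natural. apply classify_extend.
Qed.

Theorem mainTheorem3 (C : universe_category) :
  exists u1 : presheaf_mor (Ob1 C) (restrict (int C) (Yo (U (univ C)))),
    is_presheaf_iso u1 /\
    forall (n : nat) (A : Obn C n) (F : Mor (intn A) (U (univ C)))
      (T : Ob1 C (obj A)),
      proj1_sig T = obj (pairn F) -> u1 (obj A) T = F.
Proof.
exists (@PresheafMor _ (Ob1 C) (restrict (int C) (Yo (U (univ C))))
  (classify C) (classify_natural C)).
split.
- exists (@PresheafMor _ (restrict (int C) (Yo (U (univ C)))) (Ob1 C)
    (extend C) (extend_natural C)).
  split.
  + exact (extend_classify C).
  + exact (classify_extend C).
- intros n A F T. exact (classify_unique C (obj A) T F).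
Qed.
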